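(* Let $\mathbb{L} = (L,\vee,\wedge,{\sim},{^*},0,1)$ be a regular pseudocomplemented Kleene algebra whose underlying lattice $(L,\le)$ is an algebraic lattice. Then there exist a set $U$ and a tolerance $R$ on $U$ induced by an irredundant covering of $U$ such that $\mathbb{L}$ is isomorphic to the rough set algebra $\mathbb{RS} = (\mathit{RS},\vee,\wedge,{\sim},{^*},(\emptyset,\emptyset),(U,U))$ determined by $R$.
   Context: A De Morgan algebra $(L,\vee,\wedge,{\sim},0,1)$ is a bounded distributive lattice with a unary operation ${\sim}$ such that ${\sim}{\sim}x=x$ and $x\le y \iff {\sim}y\le{\sim}x$. It is a Kleene algebra if moreover $x\wedge{\sim}x\le y\vee{\sim}y$ for all $x,y$. A pseudocomplemented Kleene algebra $(L,\vee,\wedge,{\sim},{^*},0,1)$ is a Kleene algebra in which every $x$ has a pseudocomplement $x^*$ (i.e. $x\wedge z=0 \iff z\le x^*$). It then also has dual pseudocomplements $x^+ := {\sim}(({\sim}x)^* )$ (so $x\vee z=1\iff z\ge x^+$). It is called regular if $x^*=y^*$ and $x^+=y^+$ imply $x=y$. A lattice is algebraic if it is complete and every element is the join of the compact elements below it. A tolerance $R$ on a set $U$ is a reflexive symmetric binary relation; $R(x)=\{y\in U\mid x\,R\,y\}$. For $X\subseteq U$: $X^{\downarrow}=\{x\mid R(x)\subseteq X\}$, $X^{\uparrow}=\{x\mid R(x)\cap X\ne\emptyset\}$, and $X^c=U\setminus X$. A covering of $U$ is a family $\mathcal{H}$ of nonempty subsets with $\bigcup\mathcal{H}=U$; it is irredundant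 if $\mathcal{H}\setminus\{X\}$ is not a covering for any $X\in\mathcal{H}$; the tolerance induced by $\mathcal{H}$ is $\bigcup\{X\times X\mid X\in\mathcal{H}\}$. $\mathit{RS}=\{(X^{\downarrow},X^{\uparrow})\mid X\subseteq U\}$ ordered coordinatewise. When $R$ is induced by an irredundant covering, $(\mathit{RS},\le)$ is a complete distributive lattice with meets $\bigwedge (A_i,B_i)=(\bigcap A_i,(\bigcap B_i)^{\downarrow\uparrow})$ and joins $\bigvee(A_i,B_i)=((\bigcup A_i)^{\uparrow\downarrow},\bigcup B_i)$, with ${\sim}(X^{\downarrow},X^{\uparrow})=(X^{c\downarrow},X^{c\uparrow})$, and ${^*}$ the pseudocomplement in this lattice; $\mathbb{RS}$ is then a pseudocomplemented Kleene algebra. *)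

(* Defs.v *)
From HB Require Import structures.
From mathcomp Require Import all_boot all_order.
From mathcomp Require Import boolp classical_sets.

Set Implicit Arguments.
Unset Strict Implicit.
Unset Printing Implicit Defensive.

Import Order.TTheory.
Local Open Scope order_scope.
Local Open Scope classical_set_scope.

HB.mixin Record isDeMorgan d T of Order.TBDistrLattice d T := {
  dmneg : T -> T;
  dmnegK : involutive dmneg;
  le_dmneg2 : forall x y : T, (dmneg y <= dmneg x) = (x <= y)
}.

#[short(type="deMorganType")]
HB.structure Definition DeMorgan d :=
  { T of Order.TBDistrLattice d T & isDeMorgan d T }.

HB.mixin Record DeMorgan_isKleene d T of DeMorgan d T := {
  meet_dmneg_le_join_dmneg : forall x y : T,
    Order.meet x (dmneg x) <= Order.join y (dmneg y)
}.

#[short(type="kleeneType")]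
HB.structure Definition Kleene d := { T of DeMorgan d T & DeMorgan_isKleene d T }.

HB.mixin Record Kleene_isPKleene d T of Kleene d T := {
  pcompl : T -> T;
  pcomplP : forall x z : T, (Order.meet x z == \bot) = (z <= pcompl x)
}.

#[short(type="pkleeneType")]
HB.structure Definition PKleene d := { T of Kleene d T & Kleene_isPKleene d T }.

Definition dpcompl d (L : pkleeneType d) (x : L) : L := dmneg (pcompl (dmneg x)).

Definition regular_pkleene d (L : pkleeneType d) : Prop :=
  forall x y : L, pcompl x = pcompl y -> dpcompl x = dpcompl y -> x = y.

Definition pkleene_isomorphic d1 (L1 : pkleeneType d1) d2 (L2 : pkleeneType d2)
    : Prop :=
  exists f : L1 -> L2,
    [/\ bijective f,
        {morph f : x y / Order.join x y} /\ {morph f : x y / Order.meet x y},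
        {morph f : x / dmneg x},
        {morph f : x / pcompl x} &
        f \bot = \bot /\ f \top = \top].

Section Algebraic.
Context d (L : tbLatticeType d).

Definition complete_lattice : Prop := forall S : set L,
  (exists s, supremums S s) /\ (exists i, infimums S i).

Definition compact_element (c : L) : Prop := forall (S : set L) (s : L),
  supremums S s -> c <= s ->
  exists2 F : seq L, [set` F] `<=` S & c <= \join_(x <- F) x.

Definition algebraic_lattice : Prop :=
  complete_lattice /\
  forall x : L, supremums [set c | compact_element c /\ c <= x] x.

End Algebraic.

Section Rough.
Context (U : Type).
Implicit Types (R : U -> U -> Prop) (H : set (set U)) (X : set U).

Definition tolerance R : Prop :=
  (forall x, R x x) /\ (forall x y, R x y -> R y x).

Definition nbh R (x : U) : set U := [set y | R x y].

Definition lower R X : set U := [set x | nbh R x `<=` X].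
Definition upper R X : set U := [set x | nbh R x `&` X !=set0].

Definition covering H : Prop :=
  (forall X, H X -> X !=set0) /\ \bigcup_(X in H) X = setT.

Definition irredundant_covering H : Prop :=
  covering H /\ forall X, H X -> ~ covering (H `\ X).

Definition induced_tolerance H (x y : U) : Prop :=
  exists2 X, H X & X x /\ X y.

Definition induced_by_irredundant_covering R : Prop :=
  exists2 H, irredundant_covering H & forall x y, R x y <-> induced_tolerance H x y.

Record rough_set R := RoughSet {
  rsval :> set U * set U;
  rsvalP : `[< exists X, rsval = (lower R X, upper R X) >]
}.

HB.instance Definition _ R := [isSub for @rsval R].
HB.instance Definition _ R := [Choice of rough_set R by <:].

Lemma rough_subproof R X : `[< exists Y, (lower R X, upper R X) = (lower R Y, upper R Y) >].
Proof. by apply/asboolP; exists X. Qed.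

Definition rough R X : rough_set R := RoughSet (rough_subproof R X).

Lemma roughP R (p : rough_set R) : exists X, p = rough R X.
Proof. by case: (p) => q qP; case/asboolP: (qP) => X qX; exists X; apply: val_inj. Qed.

Definition rs_rep R (p : rough_set R) : set U := projT1 (cid (roughP p)).

Lemma rs_repK R (p : rough_set R) : rough R (rs_rep p) = p.
Proof. by rewrite /rs_rep; case: cid. Qed.

Definition rs_le R (p q : rough_set R) : bool :=
  `[< p.1 `<=` q.1 /\ p.2 `<=` q.2 >].

Lemma rs_le_refl R : reflexive (@rs_le R).
Proof. by move=> p; apply/asboolP; split. Qed.

Lemma rs_le_anti R : antisymmetric (@rs_le R).
Proof.
move=> [[A B] hp] [[C D] hq] /andP[/asboolP[/= h1 h2] /asboolP[/= h3 h4]].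
by apply: val_inj => /=; congr pair; apply/seteqP.
Qed.

Lemma rs_le_trans R : transitive (@rs_le R).
Proof.
move=> q p r /asboolP[h1 h2] /asboolP[h3 h4]; apply/asboolP.
by split; [apply: subset_trans h3|apply: subset_trans h4].
Qed.

End Rough.

Fact rs_display : Order.disp_t. Proof. exact: Order.Disp tt tt. Qed.

HB.instance Definition _ (U : Type) (R : U -> U -> Prop) :=
  Order.Le_isPOrder.Build rs_display (rough_set R)
    (@rs_le_refl U R) (@rs_le_anti U R) (@rs_le_trans U R).

Section Lattice.
Context (U : Type) (R : U -> U -> Prop).
Context (tolR : tolerance R) (irrR : induced_by_irredundant_covering R).
Implicit Types (X Y A B C D : set U) (p q r : rough_set R).

Notation "X ^<" := (lower R X) (at level 2, format "X ^<").
Notation "X ^>" := (upper R X) (at level 2, format "X ^>").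

Let Rxx x : R x x. Proof. exact: tolR.1. Qed.
Let Rsym x y : R x y -> R y x. Proof. exact: tolR.2. Qed.

(* [a] is a private point: its neighborhood is a block of the covering. *)
Let block a := forall x y, R a x -> R a y -> R x y.

Let blockE x y : R x y -> exists a, [/\ block a, R a x & R a y].
Proof.
case: irrR => H [[Hne HU] Hirr] RH /RH[X HX [Xx Xy]].
have [a [Xa priv]] : exists a, X a /\ forall Y, H Y -> Y a -> Y = X.
  apply: contrapT => nex; apply: (Hirr _ HX); split; first by move=> Y [/Hne].
  rewrite -subTset => z _; have : (\bigcup_(X in H) X) z by rewrite HU.
  case=> Z HZ Zz; case: (EM (Z = X)) => [ZX|ZX]; last by exists Z.
  apply: contrapT => nz; apply: nex; exists z; split; first by rewrite -ZX.
  by move=> Y HY Yz; apply: contrapT => YX; apply: nz; exists Y.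
have Ra z : R a z -> X z.
  by move=> /RH[Y HY [Ya Yz]]; rewrite -(priv _ HY Ya).
exists a; split; [|by apply/RH; exists X..].
by move=> u v /Ra Xu /Ra Xv; apply/RH; exists X.
Qed.

Let lower_sub X : X^< `<=` X.
Proof. by move=> x; apply; apply: Rxx. Qed.
Let sub_upper X : X `<=` X^>.
Proof. by move=> x Xx; exists x; split=> //; apply: Rxx. Qed.
Let lowerS X Y : X `<=` Y -> X^< `<=` Y^<.
Proof. by move=> XY x h y /h/XY. Qed.
Let upperS X Y : X `<=` Y -> X^> `<=` Y^>.
Proof. by move=> XY x [y [Rxy /XY Yy]]; exists y. Qed.
Let upper_adj X Y : X^> `<=` Y <-> X `<=` Y^<.
Proof.
split=> h x.
  by move=> Xx y Rxy; apply: h; exists x; split=> //; apply: Rsym.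
by case=> y [Rxy /h]; apply; apply: Rsym.
Qed.
Let lowerK X : X^<^> `<=` X. Proof. by apply/upper_adj. Qed.
Let upperK X : X `<=` X^>^<. Proof. exact/upper_adj. Qed.
Let lul X : X^<^>^< = X^<.
Proof. apply/seteqP; split; [exact: (lowerS (@lowerK X))|exact: (@upperK X^<)]. Qed.
Let ulu X : X^>^<^> = X^>.
Proof. apply/seteqP; split; [exact: (@lowerK X^>)|exact: (upperS (@upperK X))]. Qed.
Let upperU X Y : (X `|` Y)^> = X^> `|` Y^>.
Proof.
apply/seteqP; split=> x.
  by case=> y [Rxy []]; [left|right]; exists y.
by case=> -[y [Rxy Xy]]; exists y; split=> //; [left|right].
Qed.
Let lowerI X Y : (X `&` Y)^< = X^< `&` Y^<.
Proof.
apply/seteqP; split=> x.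
  by move=> h; split=> y /h[].
by move=> [h1 h2] y Rxy; split; [apply: h1|apply: h2].
Qed.


Let blockS a x : block a -> R a x -> nbh R a `<=` nbh R x.
Proof. by move=> ba Rax y; apply: ba. Qed.

(* A pair (A, B) satisfying these four conditions is the rough set of the set
   consisting of A^> and of one private point for each block that is included
   in B and disjoint from A^>. *)
Let rs_charac A B : A^>^< = A -> B^<^> = B -> A^> `<=` B^< ->
  (forall x, nbh R x `<=` [set x] -> B x -> A x) ->
  exists X, (A, B) = (X^<, X^>).
Proof.
move=> hA hB hAB hS.
have /boolp.choice[rp rpP] : forall S : set U, exists o : option U,
    (exists w, block w /\ nbh R w = S) ->
    exists z, [/\ o = Some z, block z & nbh R z = S].
  move=> S; case: (EM (exists w, block w /\ nbh R w = S)) => [[w [bw wS]]|h].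
    by exists (Some w) => _; exists w.
  by exists None.
pose Z := A^> `|` [set z | [/\ rp (nbh R z) = Some z, block z,
  nbh R z `<=` B & ~ (nbh R z `&` A^> !=set0)]].
exists Z; congr pair; apply/seteqP; split=> x.
- by rewrite -{1}hA; apply: lowerS => z; left.
- move=> hx; rewrite -hA => y Rxy; case: (hx y Rxy) => // -[ry by_ yB yA].
  have yw w : R y w -> w = y.
    move=> Ryw; have Rxw : R x w by apply: by_ => //; apply: Rsym.
    case: (hx w Rxw) => [wA|[rw bw _ _]].
      by case: yA; exists w.
    have E : nbh R w = nbh R y.
      by apply/seteqP; split; apply: blockS => //; apply: Rsym.
    by move: rw; rewrite E ry => -[].
  by apply/sub_upper/hS; [exact: yw|exact/yB/Rxx].
- rewrite -{1}hB => -[w [Rxw hw]]; have [a [ba Rax Raw]] := blockE Rxw.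
  have aB : nbh R a `<=` B by move=> y /(blockS ba Raw)/hw.
  case: (EM (nbh R a `&` A^> !=set0)) => [[u [Rau uA]]|nA].
    by exists u; split; [exact: ba|left].
  have [|z [rz bz za]] := rpP (nbh R a); first by exists a.
  exists z; split; last by right; split; rewrite ?za.
  have : nbh R z x by rewrite za.
  exact: Rsym.
- case=> y [Rxy [yA|[_ _ yB _]]]; last exact/yB/Rsym.
  by rewrite -hB; exists y; split=> //; apply: hAB.
Qed.

Let lul1 p : p.1^>^< = p.1. Proof. by have [X ->] := roughP p; apply: lul. Qed.
Let ulu2 p : p.2^<^> = p.2. Proof. by have [X ->] := roughP p; apply: ulu. Qed.
Let up1 p : p.1^> `<=` p.2^<.
Proof.
by have [X ->] := roughP p; apply: subset_trans (@lowerK X) (@upperK X).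
Qed.
Let sub12 p : p.1 `<=` p.2.
Proof.
by move=> x px; apply: lower_sub; apply: up1; apply: sub_upper.
Qed.
Let single p x : nbh R x `<=` [set x] -> p.2 x -> p.1 x.
Proof.
by have [X ->] := roughP p; move=> hx [y [/hx -> Xx]] z /hx ->.
Qed.
Let block1 p a u : block a -> R a u -> p.1 u -> p.1 a.
Proof.
by have [X ->] := roughP p; move=> ba Rau hu y Ray; apply: hu; apply: ba.
Qed.
Let block2 p a u : block a -> p.2 a -> R a u -> p.2 u.
Proof.
by have [X ->] := roughP p; move=> ba [y [Ray Xy]] Rau; exists y; split=> //; apply: ba.
Qed.

Lemma rs_join_subproof p q :
  `[< exists X, ((p.1 `|` q.1)^>^<, p.2 `|` q.2) = (X^<, X^>) >].
Proof.
apply/asboolP; apply: rs_charac.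
- exact: lul.
- by rewrite -{1}(ulu2 p) -{1}(ulu2 q) -upperU ulu upperU !ulu2.
- rewrite ulu upperU subUset; split; apply: (subset_trans (@up1 _)); apply: lowerS => x hx.
    by left.
  by right.
- by move=> x hx [] /(single hx) h; apply: upperK; [left|right].
Qed.

Lemma rs_meet_subproof p q :
  `[< exists X, (p.1 `&` q.1, (p.2 `&` q.2)^<^>) = (X^<, X^>) >].
Proof.
apply/asboolP; apply: rs_charac.
- by rewrite -{1}(lul1 p) -{1}(lul1 q) -lowerI lul lowerI !lul1.
- exact: ulu.
- rewrite lul lowerI subsetI; split; apply: subset_trans (@up1 _);
    by apply: upperS => x [].
- by move=> x hx /lowerK[] /(single hx) ? /(single hx).
Qed.

Definition rs_join p q : rough_set R := RoughSet (rs_join_subproof p q).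
Definition rs_meet p q : rough_set R := RoughSet (rs_meet_subproof p q).
(* The choice of the representative is irrelevant by rs_negE. *)
Definition rs_neg p : rough_set R := rough R (~` rs_rep p).
(* The pseudocomplement of p in the lattice (RS, <=), see rs_pcomplP. *)
Definition rs_pcompl p : rough_set R := rough R (~` p.2).

Lemma rs_leUx p q r : (rs_join p q <= r) = (p <= r) && (q <= r).
Proof.
apply/asboolP/andP => /=.
  case=> h1 h2; split; apply/asboolP; split=> x hx.
  - by apply/h1/upperK; left.
  - by apply: h2; left.
  - by apply/h1/upperK; right.
  - by apply: h2; right.
case=> /asboolP[h1 h2] /asboolP[h3 h4]; split; last by move=> x [/h2|/h4].
by rewrite -(lul1 r); apply: lowerS; apply: upperS => x [/h1|/h3].
Qed.

Lemma rs_lexI r p q : (r <= rs_meet p q) = (r <= p) && (r <= q).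
Proof.
apply/asboolP/andP => /=.
  case=> h1 h2; split; apply/asboolP; split=> x hx.
  - by have [] := h1 x hx.
  - by have /lowerK[] := h2 x hx.
  - by have [] := h1 x hx.
  - by have /lowerK[] := h2 x hx.
case=> /asboolP[h1 h2] /asboolP[h3 h4]; split; first by move=> x hx; split; [exact: h1|exact: h3].
by rewrite -(ulu2 r); apply: upperS; apply: lowerS => x hx; split; [exact: h2|exact: h4].
Qed.

Lemma rs_le0x p : rough R set0 <= p.
Proof.
apply/asboolP; split=> x /=; first by move=> /(_ x (Rxx x)).
by case=> y [].
Qed.

Lemma rs_lex1 p : p <= rough R setT.
Proof. by apply/asboolP; split=> x _ //=; exists x; split=> //; apply: Rxx. Qed.

Lemma rs_meetUl : left_distributive rs_meet rs_join.
Proof.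
have lI p q : rs_meet p q <= p /\ rs_meet p q <= q.
  by apply/andP; rewrite -rs_lexI.
have lU p q : p <= rs_join p q /\ q <= rs_join p q.
  by apply/andP; rewrite -rs_leUx.
move=> p q r; apply/eqP; rewrite eq_le; apply/andP; split; last first.
  rewrite rs_leUx !rs_lexI (lI _ _).2 (lI _ _).2 !andbT.
  rewrite (le_trans (lI _ _).1 (lU _ _).1).
  by rewrite (le_trans (lI _ _).1 (lU _ _).2).
apply/asboolP; split=> x.
- move=> -[hx px] y Rxy; have [a [ba Rax Ray]] := blockE Rxy.
  have ap : r.1 a by apply: block1 ba Rax px.
  have [u [Rau hu]] := hx a (Rsym Rax).
  exists a; split; first exact: Rsym.
  by case: hu => /(block1 ba Rau) ?; [left|right].
- move=> [w [Rxw hw]]; have [a [ba Rax Raw]] := blockE Rxw.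
  have [hqr ra] : (p.2 `|` q.2) a /\ r.2 a by apply: hw; apply: Rsym.
  by case: hqr => ha; [left|right]; (exists a; split; first exact: Rsym);
    move=> u Rau; split; apply: block2 ba _ Rau.
Qed.

Lemma rs_negE X : rs_neg (rough R X) = rough R (~` X).
Proof.
have key Y Z : rough R Y = rough R Z -> rough R (~` Y) <= rough R (~` Z).
  move=> /(congr1 val) /= [h1 h2]; apply/asboolP; split=> x /=.
    move=> hx y Rxy Zy; have : Y^> x by rewrite h2; exists y.
    by case=> z [/hx].
  case=> y [Rxy nYy]; apply: contrapT => nx.
  suff : Y^< x by move=> /(_ y Rxy).
  rewrite h1 => z Rxz; apply: contrapT => nZ; apply: nx.
  by exists z.
have E := rs_repK (rough R X).
by apply/eqP; rewrite eq_le !key.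
Qed.

Lemma rs_negK : involutive rs_neg.
Proof.
by move=> p; have [X ->] := roughP p; rewrite !rs_negE setCK.
Qed.

Lemma rs_le_neg2 q p : (rs_neg p <= rs_neg q) = (q <= p).
Proof.
have key p' q' : q' <= p' -> rs_neg p' <= rs_neg q'.
  have [X ->] := roughP p'; have [Y ->] := roughP q'.
  rewrite !rs_negE => /asboolP[/= h1 h2]; apply/asboolP; split=> x /=.
    move=> hx y Rxy Yy; have : X^> x by apply: h2; exists y.
    by case=> z [/hx].
  case=> y [Rxy nXy]; apply: contrapT => nx.
  suff /h1 : Y^< x by move=> /(_ y Rxy).
  by move=> z Rxz; apply: contrapT => nZ; apply: nx; exists z.
by apply/idP/idP => [/key|/key //]; rewrite !rs_negK.
Qed.

Lemma rs_kleene p q : rs_meet p (rs_neg p) <= rs_join q (rs_neg q).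
Proof.
have [X ->] := roughP p; have [Y ->] := roughP q; rewrite !rs_negE.
apply/asboolP; split=> x /=.
  by case=> /(_ x (Rxx x)) + /(_ x (Rxx x)).
by move=> _; case: (EM (Y x)) => ?; [left|right]; exists x; split=> //; apply: Rxx.
Qed.

Lemma rs_pcomplP p q : (rs_meet p q == rough R set0) = (q <= rs_pcompl p).
Proof.
have -> : (rs_meet p q == rough R set0) = (rs_meet p q <= rough R set0).
  by rewrite eq_le rs_le0x andbT.
apply/asboolP/asboolP => /= -[h1 h2].
  have dis x : ~ (p.2 `&` q.2)^< x.
    by move=> hx; have [y []] : set0^> x by apply: h2; exists x; split=> //; apply: Rxx.
  split=> x.
    move=> qx y Rxy; rewrite -(ulu2 p) => -[w [Ryw hw]].
    have [a [ba Ray Raw]] := blockE Ryw; apply: (dis a) => u Rau; split.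
      by apply: hw; apply: (blockS ba Raw).
    have : q.2^< y by apply: up1; exists x; split=> //; apply: Rsym.
    by apply; apply: (blockS ba Ray).
  rewrite -{1}(ulu2 q) => -[w [Rxw hw]]; have [a [ba Rax Raw]] := blockE Rxw.
  exists a; split; first exact: Rsym.
  move=> pa; apply: (dis a) => u Rau; split; first exact: block2 ba pa Rau.
  by apply: hw; apply: (blockS ba Raw).
split=> x.
  case=> px /h1 /(_ x (Rxx x)) h; exfalso; apply: h; exact: sub12.
case=> v [Rxv hv]; have [_ qv] := hv v (Rxx v); have [u [Rvu nu]] := h2 v qv.
by exfalso; apply: nu; have [] := hv u Rvu.
Qed.

End Lattice.

(* The rough set algebra of R; the two hypotheses are parameters of the type
   since the lattice structure of RS depends on them. *)
Definition RS (U : Type) (R : U -> U -> Prop) (tolR : tolerance R)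
  (irrR : induced_by_irredundant_covering R) : Type := rough_set R.

Section RSInstances.
Context (U : Type) (R : U -> U -> Prop).
Context (tolR : tolerance R) (irrR : induced_by_irredundant_covering R).
Local Notation RS := (RS tolR irrR).

HB.instance Definition _ := Order.POrder.copy RS (rough_set R).
HB.instance Definition _ := Order.POrder_isMeetSemilattice.Build rs_display RS
  (rs_lexI tolR irrR).
HB.instance Definition _ := Order.POrder_isJoinSemilattice.Build rs_display RS
  (rs_leUx tolR irrR).
HB.instance Definition _ := Order.hasBottom.Build rs_display RS
  (rs_le0x tolR).
HB.instance Definition _ := Order.hasTop.Build rs_display RS
  (rs_lex1 tolR).
HB.instance Definition _ := Order.Lattice_Meet_isDistrLattice.Build rs_display RS
  (rs_meetUl tolR irrR).
HB.instance Definition _ := isDeMorgan.Build rs_display RS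
  (@rs_negK U R) (@rs_le_neg2 U R).
HB.instance Definition _ := DeMorgan_isKleene.Build rs_display RS
  (rs_kleene tolR irrR).
HB.instance Definition _ := Kleene_isPKleene.Build rs_display RS
  (rs_pcomplP tolR irrR).

Lemma RS_leE (p q : RS) :
  (p <= q) = `[< (rsval p).1 `<=` (rsval q).1 /\ (rsval p).2 `<=` (rsval q).2 >].
Proof. by []. Qed.

Lemma RS_meetE (p q : RS) : rsval (Order.meet p q) =
  ((rsval p).1 `&` (rsval q).1, upper R (lower R ((rsval p).2 `&` (rsval q).2))).
Proof. by []. Qed.

Lemma RS_joinE (p q : RS) : rsval (Order.join p q) =
  (lower R (upper R ((rsval p).1 `|` (rsval q).1)), (rsval p).2 `|` (rsval q).2).
Proof. by []. Qed.

Lemma RS_dmnegE (X : set U) : dmneg (rough R X : RS) = rough R (~` X).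
Proof. exact: rs_negE. Qed.

Lemma RS_botE : rsval (\bot : RS) = (set0, set0).
Proof.
congr pair; apply/seteqP; split=> x //; first by move=> /(_ x (tolR.1 x)).
by case=> y [].
Qed.

Lemma RS_topE : rsval (\top : RS) = (setT, setT).
Proof.
congr pair; apply/seteqP; split=> x // _.
by exists x; split=> //; apply: tolR.1.
Qed.

End RSInstances.

(* Main.v *)
(* Since L is algebraic, distributive and self-dual, every element is a join of
   completely join-primes j, and g(j) = ~m, with m the largest element not above
   j, is an order-reversing involution of these. The Kleene law makes j and g(j)
   comparable, and regularity excludes chains of three completely join-primes.
   The points of U are the pairs (i, k) of completely join-primes such that
   i <= g(i) and i <= k, and each j <= g(j) has the block
   B_j = {(i, k) | i = j or k = g(j)}. Then x in L is mapped to the rough set of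
   X = {(i, k) | k <= x or g(i) <= x}, for which B_j meets X iff j <= x, and
   B_j is included in X iff g(j) <= x; these two families of conditions
   determine both the rough set of X and the element x. *)
Require Import Defs.
From mathcomp Require Import all_boot all_order.
From mathcomp Require Import boolp classical_sets.

Set Implicit Arguments.
Unset Strict Implicit.
Unset Printing Implicit Defensive.

Import Order.TTheory.
Local Open Scope order_scope.
Local Open Scope classical_set_scope.

(** * Compactness arguments in algebraic distributive lattices *)

Section AlgebraicLattices.
Context d (L : tbDistrLatticeType d).
Context (algL : algebraic_lattice L).
Implicit Types (a b c m s x y z : L) (S : set L).

(** A compact element below [a /\ s] lies below a finite join from [S], where finite distributivity
    applies; [a /\ s] is the join of such elements. *)
Lemma algebraic_sup_distr S s a b : supremums S s ->
  (forall y, S y -> Order.meet a y <= b) -> Order.meet a s <= b.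
Proof.
move=> Ss hS; have [_ /(_ (Order.meet a s))[_]] := algL; apply => c [cc].
rewrite lexI => /andP[ca cs]; have [F FS cF] := cc _ _ Ss cs.
have : Order.meet a (\join_(x <- F) x) <= b.
  elim: F FS {cF} => [|x F IHF] FS; first by rewrite big_nil meetx0 le0x.
  rewrite big_cons meetUr leUx hS ?IHF //; last by apply: FS; apply: mem_head.
  by move=> y yF; apply: FS; rewrite /= in_cons [_ \in _]yF orbT.
by apply: le_trans; rewrite lexI ca.
Qed.

Lemma chain_join_le S y0 (F : seq L) :
  S y0 -> total_on S (fun x y => x <= y) -> [set` F] `<=` S ->
  exists2 e, S e & \join_(x <- F) x <= e.
Proof.
move=> Sy0 totS; elim: F => [|x F IHF] FS.
  by exists y0 => //; rewrite big_nil le0x.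
have [|e Se Fe] := IHF.
  by move=> y yF; apply: FS; rewrite /= in_cons [_ \in _]yF orbT.
have Sx : S x by apply: FS; apply: mem_head.
by rewrite big_cons; case: (totS x e Sx Se) => h; [exists e|exists x] => //;
  rewrite leUx ?h ?Fe ?lexx //= (le_trans Fe).
Qed.

(** Zorn's lemma on the elements above [y] but not above [c]: as [c] is compact, suprema of chains
    stay in this set. *)
Lemma compact_maximal c y : compact_element c -> ~~ (c <= y) ->
  exists m, [/\ y <= m, ~~ (c <= m) &
    forall z, ~~ (z <= m) -> c <= Order.join m z].
Proof.
move=> cc ncy.
pose T := {z | y <= z /\ ~~ (c <= z)}.
have y0 : T by exists y.
have [||A totA|[m [ym cm]] maxm] :=
    @ZL_preorder T y0 (fun u v => sval u <= sval v).
- by move=> t; apply: lexx.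
- by move=> ? ? ?; apply: le_trans.
(* Adding [y] keeps [S] nonempty when the chain [A] is empty. *)
- pose S : set L := [set z | z = y \/ exists2 u, A u & sval u = z].
  have yS z : S z -> y <= z by case=> [->//|[u _ <-]]; exact: (svalP u).1.
  have totS : total_on S (fun x y => x <= y).
    move=> a b Sa Sb; case: (Sa) => [->|[u Au ua]]; first by left; apply: yS.
    case: (Sb) => [->|[v Av <-]]; first by right; apply: yS.
    by rewrite -ua; apply: totA.
  have [[s Ss] _] := algL.1 S.
  have ys : y <= s by apply: Ss.1; left.
  have ncs : ~~ (c <= s).
    apply/negP => cs; have [F FS cF] := cc _ _ Ss cs.
    have [e Se Fe] := chain_join_le (or_introl erefl : S y) totS FS.
    have := le_trans cF Fe; case: Se => [->|[u _ <-]].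
      by rewrite (negbTE ncy).
    exact/negP/(svalP u).2.
  by exists (exist _ s (conj ys ncs)) => u Au; apply: Ss.1; right; exists u.
exists m; split=> // z nzm; apply: contraNT nzm => ncmz.
have ymz : y <= Order.join m z by apply: le_trans ym (leUl _ _).
have /= := maxm (exist _ _ (conj ymz ncmz)) (leUl _ _).
by apply: le_trans; apply: leUr.
Qed.

End AlgebraicLattices.

(** * Completely join-primes and the involution [g] *)

Section PrimePairs.
Context d (L : deMorganType d).
Implicit Types (i j k l x y z : L) (S : set L).

(* As in the header, [j] is completely join-prime and [k = g j]. *)
Definition prime_pair j k : Prop := forall y, (k <= y) = ~~ (j <= dmneg y).

Lemma prime_pairC j k : prime_pair j k -> prime_pair k j.
Proof. by move=> jk y; rewrite jk dmnegK negbK. Qed.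

Lemma prime_pair_anti j k j' k' :
  prime_pair j k -> prime_pair j' k' -> (k' <= k) = (j <= j').
Proof.
have key i l i' l' : prime_pair i l -> prime_pair i' l' -> i <= i' -> l' <= l.
  move=> il il' ii'; rewrite il'; apply/negP => /(le_trans ii').
  by apply/negP; rewrite -il.
move=> jk jk'; apply/idP/idP; last exact: key.
by apply: key; apply: prime_pairC.
Qed.

Lemma prime_pair_uniq j k k' : prime_pair j k -> prime_pair j k' -> k = k'.
Proof.
move=> jk jk'; apply/eqP; rewrite eq_le.
by rewrite (prime_pair_anti jk' jk) (prime_pair_anti jk jk') !lexx.
Qed.

Lemma prime_pair_inj j j' k : prime_pair j k -> prime_pair j' k -> j = j'.
Proof. by move=> /prime_pairC jk /prime_pairC; apply: prime_pair_uniq. Qed.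

(** Otherwise all of [S], hence [s], lies below [~k], the largest element not above [j]. *)
Lemma prime_pair_sup j k S s : prime_pair j k -> supremums S s -> j <= s ->
  exists2 y, S y & j <= y.
Proof.
move=> /prime_pairC jk Ss js; apply: contrapT => nS.
have : s <= dmneg k.
  apply: Ss.2 => y Sy; rewrite -le_dmneg2 dmnegK -[k <= _]negbK.
  by rewrite -jk; apply/negP => jy; apply: nS; exists y.
by move=> /(le_trans js); rewrite jk dmnegK lexx.
Qed.

Lemma prime_pair_join j k x y : prime_pair j k ->
  (j <= Order.join x y) = (j <= x) || (j <= y).
Proof.
move=> jk; apply/idP/orP => [|[] h]; last 2 first.
- exact: le_trans h (leUl _ _).
- exact: le_trans h (leUr _ _).
move=> h; have [|z [->|->]] := prime_pair_sup (S := [set x; y]) jk _ h.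
- split=> [z [->|->]|z hz]; rewrite ?leUl ?leUr //.
  by rewrite leUx !hz //; [right|left].
- by left.
- by right.
Qed.

Lemma prime_pair_neq0 j k : prime_pair j k -> j != \bot.
Proof.
move=> jk; apply: contraTneq (lexx k) => j0.
by rewrite jk j0 le0x.
Qed.

End PrimePairs.

(** Take a compact [c] below [x] but not below [y], and [m] maximal above [y] but not above [c]. The
    meet [j] of all elements not below [m] is then itself not below [m], which makes [m] the largest
    element not above [j]. *)
Lemma prime_pair_separation d (L : deMorganType d) (x y : L) :
  algebraic_lattice L -> ~~ (x <= y) ->
  exists j k, [/\ prime_pair j k, j <= x & ~~ (j <= y)].
Proof.
move=> algL nxy.
have [c [[cc cx] ncy]] : exists c, (compact_element c /\ c <= x) /\ ~~ (c <= y).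
  apply: contrapT => nc; move/negP: nxy; apply; apply: (algL.2 x).2 => c hc.
  by apply: contrapT => /negP ncy; apply: nc; exists c.
have [m [ym ncm cm]] := compact_maximal algL cc ncy.
have [_ [j jP]] := algL.1 [set z | ~~ (z <= m)].
have njm : ~~ (j <= m).
  have Sj : supremums [set dmneg z | z in [set z | ~~ (z <= m)]] (dmneg j).
    split=> [_ [z hz <-]|b hb]; first by rewrite le_dmneg2; apply: jP.1.
    rewrite -le_dmneg2 dmnegK; apply: jP.2 => z hz.
    by rewrite -le_dmneg2 dmnegK; apply: hb; exists z.
  (* The involution turns the distributivity of [m] over an infinite meet into that over an infinite
     join. *)
  apply/negP => jm; have : Order.meet (dmneg m) (dmneg j) <= dmneg c.
    apply: (algebraic_sup_distr algL Sj) => _ [z /= hz <-].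
    have := cm z hz; rewrite -le_dmneg2; apply: le_trans.
    rewrite -le_dmneg2 dmnegK leUx -[m <= _]le_dmneg2 -[z <= _]le_dmneg2.
    by rewrite !dmnegK leIl leIr.
  rewrite (meet_idPl _) ?le_dmneg2 //; exact/negP.
have jE z : (j <= z) = ~~ (z <= m).
  apply/idP/idP => [jz|]; last exact: jP.1.
  by apply: contra njm; apply: le_trans.
exists j, (dmneg m); split.
- by move=> z; rewrite jE negbK -le_dmneg2 dmnegK.
- by rewrite jE; apply: contra ncm; apply: le_trans.
- by rewrite jE negbK.
Qed.

(** Incomparability means [j <= ~j] and [k <= ~k]; the Kleene law then gives [j <= ~k], which is
    impossible. *)
Lemma prime_pair_comparable d (L : kleeneType d) (j k : L) :
  prime_pair j k -> (j <= k) || (k <= j).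
Proof.
move=> jk; rewrite (jk j) (prime_pairC jk k) -negb_and.
apply/negP => /andP[kk jj].
have : j <= dmneg k.
  apply: (@le_trans _ _ (Order.meet j (dmneg j))); first by rewrite lexI lexx.
  apply: le_trans (meet_dmneg_le_join_dmneg j k) _.
  by rewrite leUx lexx kk.
by rewrite (prime_pairC jk) dmnegK lexx.
Qed.

(** * Regularity bounds the chains of completely join-primes *)

Section Pseudocomplements.
Context d (L : pkleeneType d).
Implicit Types (i j k l x y z : L).

Lemma eq_pcompl x y :
  (forall z, (Order.meet x z == \bot) = (Order.meet y z == \bot)) ->
  pcompl x = pcompl y.
Proof.
move=> h; apply/eqP; rewrite eq_le -!pcomplP -h !pcomplP lexx /=.
by rewrite -pcomplP h pcomplP.
Qed.

Lemma dmneg_meet_eq0 x z :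
  (Order.meet (dmneg x) z == \bot) = (Order.join x (dmneg z) == \top).
Proof.
have dm0 : dmneg \bot = \top :> L.
  by apply/eqP; rewrite -le1x -le_dmneg2 dmnegK le0x.
rewrite -lex0 -le1x -dm0 -[LHS]le_dmneg2; apply/idP/idP => /le_trans; apply.
  rewrite -[X in _ <= X]dmnegK le_dmneg2 lexI le_dmneg2 leUl.
  by rewrite -le_dmneg2 dmnegK leUr.
by rewrite leUx -[X in (X <= _) && _]dmnegK le_dmneg2 leIl le_dmneg2 leIr.
Qed.

Lemma eq_dpcompl x y :
  (forall z, (Order.join x z == \top) = (Order.join y z == \top)) ->
  dpcompl x = dpcompl y.
Proof.
move=> h; rewrite /dpcompl; congr dmneg; apply: eq_pcompl => z.
by rewrite !dmneg_meet_eq0 h.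
Qed.

(* If [i < j < l], then [j] and its lower cover [j /\ ~k] have the same
   pseudocomplement and the same dual pseudocomplement. *)
Lemma prime_pair_chain i i' j k l l' : regular_pkleene L ->
  prime_pair i i' -> prime_pair j k -> prime_pair l l' -> i < j -> ~~ (j < l).
Proof.
move=> reg ii jk ll ij; apply/negP => jl; pose m := dmneg k.
have jm z : (j <= z) = ~~ (z <= m).
  by rewrite (prime_pairC jk) -[z <= _]le_dmneg2 dmnegK.
suff : j = Order.meet j m.
  by move/esym/meet_idPl; rewrite jm lexx.
apply: reg.
  apply: eq_pcompl => z; apply/eqP/eqP => [z0|].
    by apply/eqP; rewrite -lex0 -z0 leI2 // leIl.
  move=> z0; apply/eqP; apply: contraT => jz0.
  have jz : j <= z.
    apply: le_trans (leIr z j).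
    rewrite jm; apply: contra jz0 => jzm; rewrite -lex0 -z0 !lexI leIl jzm.
    by rewrite leIr.
  (* The nonzero [i] lies below each of [j], [m] and [z]. *)
  case/negP: (prime_pair_neq0 ii); rewrite -lex0 -z0 !lexI (ltW ij).
  rewrite (le_trans (ltW ij) jz) andbT -[i <= m]negbK -jm.
  by rewrite (lt_geF ij).
apply: eq_dpcompl => z; apply/eqP/eqP => [z1|].
  (* As [l] is join-prime and not below [j], it lies below [z]; so [j <= z] and [z] is already the
     top. *)
  have : l <= Order.join j z by rewrite z1 lex1.
  rewrite (prime_pair_join _ _ ll) (lt_geF jl) /= => lz.
  apply/eqP; rewrite -le1x -z1 leUx leUr andbT.
  exact: le_trans (le_trans (ltW jl) lz) (leUr _ _).
by move=> z1; apply/eqP; rewrite -le1x -z1 leU2 // leIl.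
Qed.
End Pseudocomplements.

(** All operations except [dmneg] are determined by the order. *)
Lemma order_iso_pkleene d1 (L1 : pkleeneType d1) d2 (L2 : pkleeneType d2)
    (f : L1 -> L2) : (forall y, exists x, f x = y) ->
  {mono f : x y / x <= y} -> {morph f : x / dmneg x} ->
  pkleene_isomorphic L1 L2.
Proof.
move=> surj mono_f neg_f; have /boolp.choice[g gK] := surj.
have fI : injective f by apply: inc_inj.
have fK : cancel f g by move=> x; apply: fI; rewrite gK.
have adj x y : (f x <= y) = (x <= g y) by rewrite -{1}[y]gK mono_f.
have adj' x y : (y <= f x) = (g y <= x) by rewrite -{1}[y]gK mono_f.
have f0 : f \bot = \bot by apply/eqP; rewrite -lex0 adj le0x.
have fM : {morph f : x y / Order.meet x y}.
  move=> x y; apply/eqP; rewrite eq_le lexI !mono_f leIl leIr.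
  by rewrite adj' lexI -!adj' leIl leIr.
exists f; split=> //.
- by exists g.
- split=> // x y; apply/eqP; rewrite eq_le leUx !mono_f leUl leUr.
  by rewrite andbT adj leUx -!adj leUl leUr.
- move=> x; apply/eqP; rewrite eq_le -pcomplP -fM -f0 (inj_eq fI) pcomplP lexx.
  by rewrite adj' -pcomplP -(inj_eq fI) fM f0 gK pcomplP lexx.
- by split=> //; apply/eqP; rewrite -le1x adj' lex1.
Qed.

(** * The points, the blocks and the irredundant covering *)

Section RoughRepresentation.
Context d (L : pkleeneType d).
Context (regL : regular_pkleene L) (algL : algebraic_lattice L).
Implicit Types (i j k l x y z : L).

Definition lower_prime i : Prop := exists2 k, prime_pair i k & i <= k.

Definition is_point (ik : L * L) : Prop :=
  [/\ lower_prime ik.1, exists j, prime_pair j ik.2 & ik.1 <= ik.2].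

Definition point : Type := {ik : L * L | `[< is_point ik >]}.

Definition block j : set point :=
  [set p | (val p).1 = j \/ prime_pair j (val p).2].

Definition blocks : set (set point) := [set block j | j in lower_prime].

Definition block_rel : point -> point -> Prop := induced_tolerance blocks.

Lemma pointP (p : point) : is_point (val p).
Proof. exact/asboolP/(valP p). Qed.

(** If [i < j], then [i < j <= g(j) < g(i)] contains a forbidden chain of three. *)
Lemma lower_prime_anti i j : lower_prime i -> lower_prime j -> i <= j -> i = j.
Proof.
move=> [i' ii' iei] [j' jj' jej]; rewrite le_eqVlt => /orP[/eqP//|ij].
have ji : j < i'.
  apply: le_lt_trans jej _; rewrite lt_neqAle (prime_pair_anti ii' jj') ltW //.
  rewrite andbT; apply: contraTneq ij => ji'.
  by rewrite (prime_pair_inj ii' (j' := j)) ?ltxx // -ji'.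
by have := prime_pair_chain regL ii' jj' (prime_pairC ii') ij; rewrite ji.
Qed.

Definition diag_point i (li : lower_prime i) : point.
Proof.
exists (i, i); apply/asboolP; split=> //=; case: li => k ik _.
by exists k; apply: prime_pairC.
Defined.

(** When [j] is a lower prime too, this point is shared by the blocks of [i] and [j]. *)
Definition edge_point i j k (li : lower_prime i) (jk : prime_pair j k)
  (ik : i <= k) : point.
Proof. by exists (i, k); apply/asboolP; split=> //=; exists j. Defined.

(** The source of irredundancy. If [i = g(j)], then [j <= i], and comparable lower primes are
    equal. *)
Lemma diag_point_private i j (li : lower_prime i) :
  lower_prime j -> block j (diag_point li) -> j = i.
Proof.
move=> lj [//|/= ji]; apply: lower_prime_anti => //.
by case: lj => k jk; rewrite (prime_pair_uniq jk ji).
Qed.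

(** For [j = g(j)] a point [(j, g(c))] with [c] other than [j] would yield the chain [c < j < g(c)].
    Such a block is included in a set as soon as it meets it, which surjectivity requires. *)
Lemma block_singleton j p q : lower_prime j -> prime_pair j j ->
  block j p -> block j q -> p = q.
Proof.
move=> lj jj; suff key r : block j r -> val r = (j, j).
  by move=> /key p1 /key q1; apply: val_inj; rewrite p1 q1.
have := pointP r; rewrite /block /=.
case: (val r) => a b [/= la [c cb] ab] [aj|jb].
  rewrite aj in ab *; congr pair; apply: contrapT => bj.
  have cj : c < j.
    rewrite lt_neqAle -(prime_pair_anti cb jj) ab andbT.
    apply/eqP => cj; apply: bj; apply: (@prime_pair_uniq _ _ j) => //.
    by rewrite -cj.
  have := prime_pair_chain regL cb jj (prime_pairC cb) cj.
  by rewrite lt_neqAle ab andbT negbK => /eqP /esym.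
have bj := prime_pair_uniq jb jj; rewrite bj in ab *.
by rewrite (lower_prime_anti la lj ab).
Qed.

(** * Rough sets in terms of the blocks included and the blocks met *)

Lemma lower_blockP X p : lower block_rel X p <->
  forall j, lower_prime j -> block j p -> block j `<=` X.
Proof.
split=> [h j lj jp q jq|h q [_ [j lj <-] [jp jq]]]; last exact: h jp _ jq.
by apply: h; exists (block j) => //; exists j.
Qed.

Lemma upper_blockP X p : upper block_rel X p <->
  exists j, [/\ lower_prime j, block j p & block j `&` X !=set0].
Proof.
split=> [[q [[_ [j lj <-] [jp jq]] Xq]]|[j [lj jp [q [jq Xq]]]]].
  by exists j; split=> //; exists q.
by exists q; split=> //; exists (block j) => //; exists j.
Qed.

Lemma eq_rough_block X Y :
  (forall j, lower_prime j -> block j `<=` X <-> block j `<=` Y) ->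
  (forall j, lower_prime j ->
    block j `&` X !=set0 <-> block j `&` Y !=set0) ->
  rough block_rel X = rough block_rel Y.
Proof.
move=> hl hu; apply: val_inj; congr pair; apply/seteqP.
  split=> p /lower_blockP h; apply/lower_blockP => j lj /(h j lj);
    by move/(hl _ lj).
by split=> p /upper_blockP[j [lj jp h]]; apply/upper_blockP; exists j;
  split=> //; apply/(hu _ lj).
Qed.

Lemma block_covering p : exists2 j, lower_prime j & block j p.
Proof. by have [lp _ _] := pointP p; exists (val p).1 => //; left. Qed.

Lemma block_rel_tolerance : tolerance block_rel.
Proof.
split=> [p|p q [X HX [Xp Xq]]]; last by exists X.
by have [j lj jp] := block_covering p; exists (block j) => //; exists j.
Qed.

Lemma block_rel_irredundant : induced_by_irredundant_covering block_rel.
Proof.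
exists blocks => //; split; first split.
- by move=> _ [j lj <-]; exists (diag_point lj); left.
- rewrite -subTset => p _; have [j lj jp] := block_covering p.
  by exists (block j) => //; exists j.
move=> _ [j lj <-] [_ cov].
have [_ [[i li <-] nij] ip] :
    (\bigcup_(X in blocks `\ block j) X) (diag_point lj).
  by rewrite cov.
by apply: nij; rewrite (diag_point_private li ip).
Qed.

(* The condition [~~ (i <= ~x)] says that [g(i) <= x]. *)
Definition points_below x : set point :=
  [set p | (val p).2 <= x \/ ~~ ((val p).1 <= dmneg x)].

(** Every point [(a, b)] of the block satisfies [j <= b] and [j <= g(a)], so either way of being in
    [points_below x] gives [j <= x]. *)
Lemma block_meets_below j x : lower_prime j ->
  block j `&` points_below x !=set0 <-> j <= x.
Proof.
move=> lj; split=> [[q [jq xq]]|jx]; last first.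
  by exists (diag_point lj); split; left.
have [[a' aa' _] [b' bb'] ab] := pointP q; have [j' jj' jej] := lj.
case: xq => [bx|]; last rewrite -aa' => ax.
  by apply: le_trans bx; case: jq => [<-//|/(prime_pair_uniq jj') <-].
apply: le_trans ax; case: jq => [qj|jq].
  by move: aa'; rewrite qj => /(prime_pair_uniq jj') <-.
by rewrite (prime_pair_anti aa' (prime_pairC jj')) -(prime_pair_uniq jq jj').
Qed.

(** The point [(j, g(j))] is decisive: for it, both conditions in [points_below x] say
    [g(j) <= x]. *)
Lemma block_sub_below j k x : lower_prime j -> prime_pair j k ->
  block j `<=` points_below x <-> k <= x.
Proof.
move=> lj jk; split=> [h|kx q [qj|jq]].
- have jek : j <= k.
    by have [k' jk' jek'] := lj; rewrite (prime_pair_uniq jk jk').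
  have : block j (edge_point lj jk jek) by left.
  by move=> /h [//|]; rewrite -jk.
- by right; rewrite qj -jk.
- by left; rewrite (prime_pair_uniq jq jk).
Qed.

(** * The isomorphism *)

Let RSL := RS block_rel_tolerance block_rel_irredundant.

Definition rough_below x : RSL := rough block_rel (points_below x).

Lemma rough_below_mono : {mono rough_below : x y / x <= y}.
Proof.
move=> x y; rewrite RS_leE; apply/asboolP/idP => [[/= hl hu]|xy]; last first.
  split=> p; first move/lower_blockP => h; last move/upper_blockP.
    apply/lower_blockP => j lj jp; have [k jk _] := lj.
    apply/(block_sub_below _ lj jk); apply: le_trans xy.
    exact/(block_sub_below _ lj jk)/h.
  move=> [j [lj jp /(block_meets_below _ lj) jx]]; apply/upper_blockP.
  exists j; split=> //; apply/(block_meets_below _ lj); exact: le_trans xy.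
apply: contraT => /(prime_pair_separation algL)[j [k [jk jx /negP nj]]].
(* A lower prime [j] is detected by the upper approximation at its diagonal point; otherwise [k] is
   a lower prime with [j = g(k)], and the lower approximation at its diagonal point detects [j]. *)
exfalso; apply: nj; have [jek|kej] := orP (prime_pair_comparable jk).
  have lj : lower_prime j by exists k.
  have : upper block_rel (points_below x) (diag_point lj).
    apply/upper_blockP; exists j; split=> //; first by left.
    exact/(block_meets_below _ lj).
  move=> /hu /upper_blockP[i [li /(diag_point_private li) ->]].
  by move/(block_meets_below _ lj).
have kj := prime_pairC jk; have lk : lower_prime k by exists j.
have : lower block_rel (points_below x) (diag_point lk).
  apply/lower_blockP => i li /(diag_point_private li) ->.
  exact/(block_sub_below _ lk kj).
move=> /hl /lower_blockP /(_ k lk) h.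
by apply/(block_sub_below _ lk kj); apply: h; left.
Qed.

(** [points_below (~x)] can differ from the complement of [points_below x], but both include and
    meet the same blocks, since [g(j) <= ~x] exactly when [j <= x] fails. *)
Lemma rough_below_dmneg : {morph rough_below : x / dmneg x}.
Proof.
move=> x; rewrite RS_dmnegE; apply: eq_rough_block => j lj.
  have [k jk _] := lj; rewrite (block_sub_below _ lj jk) jk dmnegK.
  split=> [/negP nj p jp xp|h]; last first.
    apply/negP => /(block_meets_below _ lj)[p [jp xp]]; exact: h xp.
  by apply: nj; apply/(block_meets_below _ lj); exists p.
have [k jk _] := lj; rewrite (block_meets_below _ lj) (prime_pairC jk) dmnegK.
split=> [/negP nk|[p [jp nxp]]]; last first.
  by apply/negP => /(block_sub_below _ lj jk) /(_ p jp).
apply: contrapT => h; apply: nk; apply/(block_sub_below _ lj jk) => p jp.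
by apply: contrapT => nxp; apply: h; exists p.
Qed.

Lemma rough_below_surj (p : RSL) : exists x, rough_below x = p.
Proof.
have [X ->] := roughP p.
(* The supremum of [S] is the only candidate for [x]: it collects the primes that [X] forces below
   [x]. Complete primeness shows that no other prime gets below it. *)
pose S : set L := [set y | lower_prime y /\ block y `&` X !=set0 \/
  exists2 j, lower_prime j /\ prime_pair j y & block j `<=` X].
have [[x Sx] _] := algL.1 S; exists x; apply: eq_rough_block => j lj.
  have [k jk jek] := lj; rewrite (block_sub_below _ lj jk).
  split=> [kx|jX]; last by apply: Sx.1; right; exists j.
  have [y [[ly [q [yq Xq]]]|[i [li iy] iX]]] :=
    prime_pair_sup (prime_pairC jk) Sx kx => ky.
    (* Here [j <= g(j) <= y] forces [g(j) = j], so the block is a single point. *)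
    have jy := lower_prime_anti lj ly (le_trans jek ky).
    have kj : k = j by apply/eqP; rewrite eq_le jek andbT jy.
    rewrite kj in jk; rewrite -jy in yq.
    by move=> q' jq'; rewrite (block_singleton lj jk jq' yq).
  rewrite (prime_pair_anti iy jk) in ky.
  by rewrite -(lower_prime_anti li lj ky).
rewrite (block_meets_below _ lj).
split=> [jx|jX]; last by apply: Sx.1; left.
have [k jk jek] := lj.
have [y [[ly yX]|[i [li iy] iX]] jy] := prime_pair_sup jk Sx jx.
  by rewrite (lower_prime_anti lj ly jy).
(* The point [(j, g(i))] lies in the block of [j] and in that of [i], hence in [X]. *)
by exists (edge_point lj iy jy); split; [left|apply: iX; right].
Qed.

End RoughRepresentation.

Theorem theorem5p3 (d : Order.disp_t) (L : pkleeneType d) :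
  regular_pkleene L -> algebraic_lattice L ->
  exists (U : Type) (R : U -> U -> Prop)
    (tolR : tolerance R) (irrR : induced_by_irredundant_covering R),
    pkleene_isomorphic L (RS tolR irrR).
Proof.
move=> regL algL; exists (point L), (@block_rel _ L).
exists (@block_rel_tolerance _ L), (block_rel_irredundant regL).
apply: order_iso_pkleene.
- exact: rough_below_surj.
- exact: rough_below_mono.
- exact: rough_below_dmneg.
Qed.
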